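(* Let $f$ be a real homogeneous polynomial in the two variables $(x^1,x^2)$ and let $P\subset\mathbb{R}^3$ be its graph $x^3=f(x^1,x^2)$. Then \[ \inf_{p\in P}\frac{|\kappa_1(p)-\kappa_2(p)|}{d_\infty(p)}=0 . \]
   Context: Here $\kappa_1,\kappa_2$ are the principal curvatures of $P$. Write $z=x^1+ix^2$. Let $\xi$ be the holomorphic (stereographic) coordinate about the North pole of $\mathbb{S}^2$, for which the unit vector corresponding to $\xi$ has components $\frac{2\xi}{1+\xi\bar\xi}\in\mathbb{C}\cong\mathbb{R}^2$ and $\frac{1-\xi\bar\xi}{1+\xi\bar\xi}\in\mathbb{R}$. The upward unit normal of $P$ at the point over $z$ has coordinate $\xi=\xi(z,\bar z)$ with $|\xi|<1$ and $\frac{\xi}{1-\xi\bar\xi}=-\partial_{\bar z}f$. The distance to infinity of $p\in P$ is $d_\infty(p)=1-|\xi(p)|>0$. *)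

(* Defs.v *)
From mathcomp Require Import all_boot all_order all_algebra.
From mathcomp Require Import mpoly complex ring lra.
From mathcomp Require Import boolp classical_sets reals.

Set Implicit Arguments.
Unset Strict Implicit.
Unset Printing Implicit Defensive.

Import Order.TTheory GRing.Theory Num.Theory ComplexField.Normc.
Local Open Scope classical_set_scope.
Local Open Scope complex_scope.
Local Open Scope ring_scope.

Definition vec3 (R : realType) (a b c : R) : 'rV[R]_3 :=
  \row_(i < 3) [:: a; b; c]`_i.

Definition dotv (R : realType) (n : nat) (u v : 'rV[R]_n) : R :=
  (u *m v^T) 0 0.

(* The projection (x^1, x^2, x^3) |-> (x^1, x^2). *)
Definition base_point (R : realType) (p : 'rV[R]_3) : 'rV[R]_2 :=
  \row_(i < 2) p 0 (widen_ord (leqnSn 2) i).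

Definition graph (R : realType) (f : {mpoly R[2]}) : set 'rV[R]_3 :=
  [set p : 'rV[R]_3 | p 0 2 = f.@[(base_point p) 0]].

Definition pd (R : realType) (f : {mpoly R[2]}) (i : 'I_2) (x : 'rV[R]_2) : R :=
  (f^`M(i)).@[x 0].

Definition pd2 (R : realType) (f : {mpoly R[2]}) (i j : 'I_2)
    (x : 'rV[R]_2) : R :=
  (f^`M(i)^`M(j)).@[x 0].

(* First and second partial derivatives of the chart (x^1, x^2) |->
   (x^1, x^2, f (x^1, x^2)) of the graph. *)
Definition chart_d (R : realType) (f : {mpoly R[2]}) (i : 'I_2)
    (x : 'rV[R]_2) : 'rV[R]_3 :=
  vec3 (i == 0)%:R (i == 1)%:R (pd f i x).

Definition chart_d2 (R : realType) (f : {mpoly R[2]}) (i j : 'I_2)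
    (x : 'rV[R]_2) : 'rV[R]_3 :=
  vec3 0 0 (pd2 f i j x).

Definition unit_normal (R : realType) (f : {mpoly R[2]}) (x : 'rV[R]_2) :
    'rV[R]_3 :=
  (Num.sqrt (1 + pd f 0 x ^+ 2 + pd f 1 x ^+ 2))^-1 *:
    vec3 (- pd f 0 x) (- pd f 1 x) 1.

Definition first_form (R : realType) (f : {mpoly R[2]}) (x : 'rV[R]_2) :
    'M[R]_2 :=
  \matrix_(i, j) dotv (chart_d f i x) (chart_d f j x).

Definition second_form (R : realType) (f : {mpoly R[2]}) (x : 'rV[R]_2) :
    'M[R]_2 :=
  \matrix_(i, j) dotv (chart_d2 f i j x) (unit_normal f x).

(* Matrix of the shape operator (acting on columns) in the basis formed by the
   two coordinate tangent vectors chart_d. *)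
Definition shape_operator (R : realType) (f : {mpoly R[2]}) (x : 'rV[R]_2) :
    'M[R]_2 :=
  invmx (first_form f x) *m second_form f x.

(* k1, k2 are the eigenvalues, with multiplicity, of the shape operator at p. *)
Definition principal_curvatures (R : realType) (f : {mpoly R[2]})
    (p : 'rV[R]_3) (k1 k2 : R) : Prop :=
  char_poly (shape_operator f (base_point p)) = ('X - k1%:P) * ('X - k2%:P).

(* The unit vector corresponding to the holomorphic coordinate xi. *)
Definition sphere_point (R : realType) (xi : R[i]) : 'rV[R]_3 :=
  let s := normc xi ^+ 2 in
  vec3 (2 * complex.Re xi / (1 + s)) (2 * complex.Im xi / (1 + s))
    ((1 - s) / (1 + s)).

(* The holomorphic coordinate of the upward unit normal n of the graph, i.e.
   (n^1 + i n^2) / (1 + n^3). That this inverts sphere_point, and the formula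
   xi / (1 - xi xi^* ) = - dzbar f, are proved below. *)
Definition normal_coord (R : realType) (f : {mpoly R[2]}) (p : 'rV[R]_3) :
    R[i] :=
  let n := unit_normal f (base_point p) in
  (n 0 0 / (1 + n 0 2)) +i* (n 0 1 / (1 + n 0 2)).

Definition d_infty (R : realType) (f : {mpoly R[2]}) (p : 'rV[R]_3) : R :=
  1 - normc (normal_coord f p).

(* The Wirtinger derivative of f with respect to the conjugate of
   z = x^1 + i x^2. *)
Definition dzbar (R : realType) (f : {mpoly R[2]}) (x : 'rV[R]_2) : R[i] :=
  (pd f 0 x / 2) +i* (pd f 1 x / 2).

Lemma vec3_eq (R : realType) (u v : 'rV[R]_3) :
  u 0 0 = v 0 0 -> u 0 1 = v 0 1 -> u 0 2 = v 0 2 -> u = v.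
Proof.
move=> h0 h1 h2; apply/rowP => i.
have : [|| i == 0, i == 1 | i == 2] by case: i => [[|[|[|]]]].
by case/or3P => /eqP ->.
Qed.

Lemma dotv3 (R : realType) (u v : 'rV[R]_3) :
  dotv u v = u 0 0 * v 0 0 + u 0 1 * v 0 1 + u 0 2 * v 0 2.
Proof.
rewrite /dotv mxE !big_ord_recl big_ord0 !mxE addr0 addrA.
by congr (_ + _ + _); congr (u _ _ * v _ _); apply: val_inj.
Qed.

Lemma unit_normalE (R : realType) (f : {mpoly R[2]}) (x : 'rV[R]_2) :
  let W := Num.sqrt (1 + pd f 0 x ^+ 2 + pd f 1 x ^+ 2) in
  [/\ unit_normal f x 0 0 = - pd f 0 x / W,
      unit_normal f x 0 1 = - pd f 1 x / W &
      unit_normal f x 0 2 = W^-1].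
Proof. by move=> W; rewrite !mxE /= -/W mulr1 ![W^-1 * _]mulrC. Qed.

Lemma normal_lengthP (R : realType) (a b : R) :
  let W := Num.sqrt (1 + a ^+ 2 + b ^+ 2) in
  1 <= W /\ W ^+ 2 = 1 + a ^+ 2 + b ^+ 2.
Proof.
move=> W; have h : 1 <= 1 + a ^+ 2 + b ^+ 2.
  by rewrite -addrA lerDl addr_ge0 ?sqr_ge0.
split; last by rewrite sqr_sqrtr // (le_trans _ h).
by rewrite -[X in X <= _]sqrtr1 ler_wsqrtr.
Qed.

Lemma unit_normalP (R : realType) (f : {mpoly R[2]}) (x : 'rV[R]_2) :
  [/\ dotv (unit_normal f x) (unit_normal f x) = 1,
      forall i, dotv (unit_normal f x) (chart_d f i x) = 0 &
      0 < unit_normal f x 0 2].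
Proof.
have [e0 e1 e2] := unit_normalE f x.
have [W1] := normal_lengthP (pd f 0 x) (pd f 1 x).
move: e0 e1 e2 W1; set W := Num.sqrt _ => e0 e1 e2 W1 W2.
have W0 : W != 0 by rewrite gt_eqF // (lt_le_trans _ W1).
split.
- rewrite dotv3 e0 e1 e2.
  transitivity ((1 + pd f 0 x ^+ 2 + pd f 1 x ^+ 2) / W ^+ 2); first by field.
  by rewrite -W2 divff // expf_neq0.
- move=> i; rewrite dotv3 e0 e1 e2 !mxE /=.
  have : (i == 0) || (i == 1) by case: i => [[|[|]]].
  by case/orP => /eqP -> /=; field.
- by rewrite e2 invr_gt0 (lt_le_trans _ W1).
Qed.

Lemma normal_coordE (R : realType) (f : {mpoly R[2]}) (p : 'rV[R]_3) :
  let x := base_point p in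
  let W := Num.sqrt (1 + pd f 0 x ^+ 2 + pd f 1 x ^+ 2) in
  normal_coord f p = (- pd f 0 x / (1 + W)) +i* (- pd f 1 x / (1 + W)).
Proof.
move=> x W; rewrite /normal_coord /= -/x.
have [-> -> ->] := unit_normalE f x.
have [] := normal_lengthP (pd f 0 x) (pd f 1 x); rewrite -/W => W1 _.
have W0 : W != 0 by rewrite gt_eqF // (lt_le_trans _ W1).
have W2 : 1 + W != 0 by rewrite gt_eqF //; lra.
have W3 : 1 + W^-1 != 0.
  by rewrite gt_eqF // addr_gt0 // invr_gt0 (lt_le_trans _ W1).
by congr (_ +i* _); field; rewrite W0 /= ?W2 // addrC.
Qed.

Lemma normc_normal_coord (R : realType) (f : {mpoly R[2]}) (p : 'rV[R]_3) :
  let x := base_point p in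
  let W := Num.sqrt (1 + pd f 0 x ^+ 2 + pd f 1 x ^+ 2) in
  normc (normal_coord f p) ^+ 2 = (W - 1) / (W + 1).
Proof.
move=> x W; rewrite normal_coordE -/x -/W /= sqr_sqrtr ?addr_ge0 ?sqr_ge0 //.
have [] := normal_lengthP (pd f 0 x) (pd f 1 x); rewrite -/W => W1 W2.
have W3 : 1 + W != 0 by rewrite gt_eqF //; lra.
transitivity ((W ^+ 2 - 1) / (1 + W) ^+ 2).
  by rewrite W2; field.
by field; rewrite ?W3 // addrC.
Qed.

Lemma normc_normal_coord_lt1 (R : realType) (f : {mpoly R[2]}) (p : 'rV[R]_3) :
  normc (normal_coord f p) < 1.
Proof.
have n0 : 0 <= normc (normal_coord f p).
  by case: (normal_coord f p) => a b; exact: sqrtr_ge0.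
rewrite -(ltr_pXn2r (n:=2)) ?nnegrE // expr1n normc_normal_coord /=.
set W := Num.sqrt _.
have [] := normal_lengthP (pd f 0 (base_point p)) (pd f 1 (base_point p)).
rewrite -/W => W1 _.
by rewrite ltr_pdivrMr; lra.
Qed.

Lemma d_infty_gt0 (R : realType) (f : {mpoly R[2]}) (p : 'rV[R]_3) :
  0 < d_infty f p.
Proof. by rewrite subr_gt0 normc_normal_coord_lt1. Qed.

Lemma sphere_point_normal_coord (R : realType) (f : {mpoly R[2]})
    (p : 'rV[R]_3) :
  sphere_point (normal_coord f p) = unit_normal f (base_point p).
Proof.
rewrite /sphere_point normc_normal_coord normal_coordE /=.
have [e0 e1 e2] := unit_normalE f (base_point p).
have [] := normal_lengthP (pd f 0 (base_point p)) (pd f 1 (base_point p)).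
move: e0 e1 e2; set W := Num.sqrt _ => e0 e1 e2 W1 _.
have W0 : W != 0 by rewrite gt_eqF // (lt_le_trans _ W1).
have W2 : W + 1 != 0 by rewrite gt_eqF //; lra.
have W4 : W + W != 0 by rewrite gt_eqF //; lra.
have W5 : W + 1 + (W - 1) != 0 by rewrite gt_eqF //; lra.
by apply: vec3_eq; rewrite ?(e0, e1, e2) mxE /=; field; rewrite ?W0 ?W2 ?W5.
Qed.

Lemma normal_coord_dzbar (R : realType) (f : {mpoly R[2]}) (p : 'rV[R]_3) :
  let xi := normal_coord f p in
  xi / (1 - xi * xi^*) = - dzbar f (base_point p).
Proof.
move=> xi; rewrite -sqr_normc.
have -> : `|xi| ^+ 2 = (normc xi ^+ 2)%:C by rewrite rmorphXn.
rewrite normc_normal_coord /xi normal_coordE.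
have [] := normal_lengthP (pd f 0 (base_point p)) (pd f 1 (base_point p)).
set W := Num.sqrt _ => W1 _.
have W2 : W + 1 != 0 by rewrite gt_eqF //; lra.
rewrite -(rmorph1 (real_complex R)) -rmorphB -fmorphV /dzbar /=.
have -> : 1 - (W - 1) / (W + 1) = 2 / (W + 1) by field.
by simpc; congr (_ +i* _); field; rewrite ?W2 // addrC.
Qed.

Lemma det2 (R : comNzRingType) (A : 'M[R]_2) :
  \det A = A 0 0 * A 1 1 - A 0 1 * A 1 0.
Proof.
rewrite (expand_det_row _ 0) !big_ord_recl big_ord0 addr0 /cofactor !det_mx11.
rewrite !mxE /= expr0 mul1r expr1 mulN1r mulrN.
by congr (_ * _ - _ * _); congr (A _ _); apply: val_inj.
Qed.

Lemma first_form_unit (R : realType) (f : {mpoly R[2]}) (x : 'rV[R]_2) :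
  first_form f x \in unitmx.
Proof.
rewrite unitmxE unitfE det2 !mxE !dotv3 !mxE /=.
have h := sqr_ge0 (pd f 0 x); have h' := sqr_ge0 (pd f 1 x).
by rewrite gt_eqF //; nra.
Qed.

Lemma char_poly2 (R : comNzRingType) (A : 'M[R]_2) :
  char_poly A = 'X^2 - (A 0 0 + A 1 1)%:P * 'X + (\det A)%:P.
Proof.
rewrite /char_poly !det2 !mxE /= !mulr1n !mulr0n !sub0r.
by rewrite !(polyCD, polyCN, polyCM); ring.
Qed.

(* Every point of the graph has principal curvatures. *)
Lemma principal_curvatures_exist (R : realType) (f : {mpoly R[2]})
    (p : 'rV[R]_3) : exists k1 k2, principal_curvatures f p k1 k2.
Proof.
set x := base_point p.
set S := shape_operator f x.
pose a := pd f 0 x; pose b := pd f 1 x.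
pose D := 1 + a ^+ 2 + b ^+ 2.
have D0 : D != 0.
  by rewrite gt_eqF //; have := sqr_ge0 a; have := sqr_ge0 b; rewrite /D; lra.
have IS : first_form f x *m S = second_form f x.
  by rewrite mulKVmx // first_form_unit.
pose l := second_form f x 0 0; pose m := second_form f x 0 1.
pose n := second_form f x 1 1.
have m' : second_form f x 1 0 = m.
  by rewrite /m !mxE !dotv3 !mxE /= /pd2 mderiv_comm.
pose E := 1 + a ^+ 2; pose F := a * b; pose G := 1 + b ^+ 2.
have I00 : first_form f x 0 0 = E by rewrite !mxE dotv3 !mxE /= /E /a; ring.
have I01 : first_form f x 0 1 = F by rewrite !mxE dotv3 !mxE /= /F /a /b; ring.
have I10 : first_form f x 1 0 = F by rewrite !mxE dotv3 !mxE /= /F /a /b; ring.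
have I11 : first_form f x 1 1 = G by rewrite !mxE dotv3 !mxE /= /G /b; ring.
have eqS i j : second_form f x i j =
    first_form f x i 0 * S 0 j + first_form f x i 1 * S 1 j.
  rewrite -IS mxE !big_ord_recl big_ord0 addr0.
  by congr (_ + _ * _); congr (fun_of_matrix _ _ _); apply: val_inj.
have e00 := eqS 0 0; have e01 := eqS 0 1.
have e10 := eqS 1 0; have e11 := eqS 1 1.
rewrite m' I10 I11 in e10; rewrite I00 I01 -/l in e00.
rewrite I00 I01 -/m in e01; rewrite I10 I11 -/n in e11.
have DE : D = E * G - F ^+ 2 by rewrite /D /E /F /G; ring.
set t := S 0 0 + S 1 1; pose delta := \det S.
have d0 : 0 <= t ^+ 2 - 4 * delta.
  have E0 : 0 < E by rewrite /E; have := sqr_ge0 a; lra.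
  have Dp : 0 < D by rewrite /D; have := sqr_ge0 a; have := sqr_ge0 b; lra.
  rewrite -(pmulr_rge0 _ (exprn_gt0 2 (mulr_gt0 Dp E0))).
  have -> : (D * E) ^+ 2 * (t ^+ 2 - 4 * delta) =
      4 * D * (E * m - F * l) ^+ 2
      + (E * (E * n - G * l) - 2 * F * (E * m - F * l)) ^+ 2.
    have tD : D * t = G * l - 2 * F * m + E * n.
      transitivity (G * l - F * m - F * m + E * n); last by ring.
      by rewrite DE /t {1}e10 e01 e00 e11; ring.
    have dD : D * delta = l * n - m ^+ 2.
      by rewrite DE /delta det2 (expr2 m) {1}e10 e01 e00 e11; ring.
    transitivity (E ^+ 2 * ((D * t) ^+ 2 - 4 * D * (D * delta))); first by ring.
    by rewrite tD dD DE; ring.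
  rewrite addr_ge0 ?sqr_ge0 // mulr_ge0 ?sqr_ge0 //.
  by rewrite mulr_ge0 // ltW.
pose r := Num.sqrt (t ^+ 2 - 4 * delta).
have r2 : r ^+ 2 = t ^+ 2 - 4 * delta by rewrite sqr_sqrtr.
pose k1 := (t + r) / 2; pose k2 := (t - r) / 2; exists k1, k2.
have tk : t = k1 + k2 by rewrite /k1 /k2; field.
have dk : delta = k1 * k2.
  transitivity ((t ^+ 2 - r ^+ 2) / 4); last by rewrite /k1 /k2; field.
  by rewrite r2; field.
rewrite /principal_curvatures -/x -/S char_poly2 -/t -/delta tk dk.
by move: k1 k2 {tk dk} => k1 k2; rewrite polyCD polyCM; ring.
Qed.

(* The set whose infimum is studied is nonempty and bounded below, so inf does
   not take its junk value. *)
Lemma curvature_ratio_has_inf (R : realType) (f : {mpoly R[2]})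
    (kappa1 kappa2 : 'rV[R]_3 -> R) :
  has_inf [set `|kappa1 p - kappa2 p| / d_infty f p | p in graph f].
Proof.
split; last first.
  by exists 0 => _ [p _ <-]; rewrite divr_ge0 // ltW // d_infty_gt0.
pose p := vec3 0 0 (f.@[fun=> 0]) : 'rV[R]_3.
exists (`|kappa1 p - kappa2 p| / d_infty f p); exists p => //=.
rewrite /graph /= mxE /=; apply: meval_eq => i; rewrite !mxE.
by case: i => [[|[|]]].
Qed.

(* Main.v *)
(** If [d <> 2] the Hessian of [f] vanishes at the origin, which is therefore an
umbilic. For [d = 2] with Hessian [[A, B], [B, C]] and gradient [(a, b)], put
[D = 1 + a^2 + b^2] and [T = (1 + b^2) A - 2 a b B + (1 + a^2) C]; then
[D^3 (k1 - k2)^2 = T^2 - 4 D (A C - B^2)], while [d_infty >= 1 / (2 sqrt D)], so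
the squared ratio is at most [4 (T^2 - 4 D (A C - B^2)) / D^2]. If
[A C - B^2 > 0], there is an umbilic: the Hessian is [l] times the first
fundamental form, where [l] is its eigenvalue of least absolute value. Otherwise
[T = A + C + 2 f (A C - B^2)] stays bounded along a line on which
[f (A C - B^2) = 0], and on such a line, chosen with nonzero gradient, [D] tends
to infinity. *)

Require Import Defs.
From mathcomp Require Import all_boot all_order all_algebra.
From mathcomp Require Import mpoly complex ring lra.
From mathcomp Require Import boolp classical_sets reals.
Set Implicit Arguments.
Unset Strict Implicit.
Unset Printing Implicit Defensive.

Import Order.TTheory GRing.Theory Num.Theory ComplexField.Normc.
Local Open Scope classical_set_scope.
Local Open Scope ring_scope.

(** * Homogeneous polynomials, their derivatives and Euler's identity *)

Lemma homog_mderiv (R : nzRingType) (n d : nat) (p : {mpoly R[n]}) (i : 'I_n) :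
  p \is d.-homog -> p^`M(i) \is d.-1.-homog.
Proof.
move=> hp; apply/dhomogP => m; rewrite mcoeff_msupp mcoeff_deriv => h.
have : (m + U_(i))%MM \in msupp p.
  by rewrite mcoeff_msupp; apply: contraNneq h => ->; rewrite mul0rn.
by move/(dhomog_mf hp) => /= <-; rewrite mdegD mdeg1 addn1.
Qed.

Lemma homog0_const (R : nzRingType) (n : nat) (p : {mpoly R[n]}) :
  p \is 0.-homog -> p = (p@_0%MM)%:MP.
Proof.
move=> hp; apply/mpolyP => m; rewrite mcoeffC.
have [->|m0] := eqVneq m 0%MM; first by rewrite mulr1.
by rewrite mulr0 (dhomog_nemf_coeff hp) // mdeg_eq0.
Qed.

Lemma homog_meval0 (R : comNzRingType) (n d : nat) (p : {mpoly R[n]})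
    (v : 'I_n -> R) :
  p \is d.+1.-homog -> (forall i, v i = 0) -> p.@[v] = 0.
Proof.
move=> hp v0; rewrite mevalE big_seq big1 // => m /(dhomog_mf hp) md.
suff [i mi] : exists i, m i != 0%N.
  by rewrite (bigD1 i) //= v0 expr0n (negbTE mi) mul0r mulr0.
apply/existsP; apply: contraT => /existsPn h.
move: md => /=; rewrite mdegE big1 // => i _.
by have := h i; rewrite negbK => /eqP.
Qed.

Lemma mderivX_mulX (R : comNzRingType) (n : nat) (m : 'X_{1..n}) (i : 'I_n) :
  'X_i * 'X_[m]^`M(i) = (m i)%:R *: 'X_[m] :> {mpoly R[n]}.
Proof.
rewrite mderivX -scalerAr -mpolyXD.
(* When [m i = 0] the exponent subtraction is truncated, but the coefficient kills that term. *)
have [->|mi] := eqVneq (m i) 0%N; first by rewrite !scale0r.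
by rewrite addmC submK // lep1mP.
Qed.

(** Each monomial is an eigenvector of the Euler operator, with its degree as eigenvalue. *)
Lemma homog_euler (R : comNzRingType) (n d : nat) (p : {mpoly R[n]})
    (v : 'I_n -> R) :
  p \is d.-homog -> d%:R * p.@[v] = \sum_(i < n) v i * p^`M(i).@[v].
Proof.
move=> hp; rewrite -mevalZ.
transitivity ((\sum_(i < n) 'X_i * p^`M(i)).@[v]); last first.
  by rewrite rmorph_sum; apply: eq_bigr => i _; rewrite /= mevalM mevalXU.
congr (_.@[v]).
transitivity (\sum_(m <- msupp p) p@_m *: (d%:R *: 'X_[m]) : {mpoly R[n]}).
  rewrite {1}[p]mpolyE scaler_sumr.
  by apply: eq_bigr => m _; rewrite !scalerA mulrC.
under [RHS]eq_bigr => i _.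
  rewrite {1}[p]mpolyE raddf_sum mulr_sumr.
  under eq_bigr => m _ do rewrite /= mderivZ -scalerAr mderivX_mulX.
  over.
rewrite exchange_big /= big_seq [RHS]big_seq.
apply: eq_bigr => m /(dhomog_mf hp) /= <-.
by rewrite -scaler_sumr -scaler_suml mdegE natr_sum.
Qed.

(** For [d >= 3] the second derivatives are homogeneous of positive degree; for [d <= 1] the first
    derivatives are already constant. *)
Lemma homog_mderiv2_0 (R : comNzRingType) (n d : nat) (p : {mpoly R[n]})
    (i j : 'I_n) (v : 'I_n -> R) :
  p \is d.-homog -> d != 2 -> (forall i, v i = 0) -> p^`M(i)^`M(j).@[v] = 0.
Proof.
case: d => [|[|[|d]]] //; last first.
- by move=> hp _; exact: homog_meval0 (homog_mderiv j (homog_mderiv i hp)).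
- move=> hp _ _; have /homog0_const -> := homog_mderiv i hp.
  by rewrite mderivC meval0.
- by move=> /homog0_const -> _ _; rewrite mderivC mderiv0 meval0.
Qed.

Lemma homog2_pd2 (R : realType) (f : {mpoly R[2]}) (i j : 'I_2)
    (x : 'rV[R]_2) : f \is 2.-homog -> pd2 f i j x = pd2 f i j 0.
Proof.
move=> hf; rewrite /pd2.
have /homog0_const -> := homog_mderiv j (homog_mderiv i hf).
by rewrite !mevalC.
Qed.

(** Euler's identity for a first partial derivative, which is a linear form: the gradient is the
    constant Hessian applied to [x]. *)
Lemma homog2_pd (R : realType) (f : {mpoly R[2]}) (i : 'I_2)
    (x : 'rV[R]_2) : f \is 2.-homog ->
  pd f i x = pd2 f i 0 0 * x 0 0 + pd2 f i 1 0 * x 0 1.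
Proof.
move=> hf; have := homog_euler (x 0) (homog_mderiv i hf).
rewrite mul1r => e; rewrite /pd e !big_ord_recl big_ord0 addr0.
rewrite -(homog2_pd2 i 0 x hf) -(homog2_pd2 i 1 x hf) /pd2.
have -> : lift ord0 ord0 = 1 :> 'I_2 by exact: val_inj.
have -> : ord0 = 0 :> 'I_2 by exact: val_inj.
by rewrite ![x 0 _ * _]mulrC.
Qed.

(** * Curvature gap, distance to infinity and their ratio *)

(** The squared gap is the discriminant, trace squared minus four times the determinant, of the
    shape operator; [D] is the determinant of the first form. *)
Lemma principal_curvature_gap (R : realType) (f : {mpoly R[2]})
    (p : 'rV[R]_3) (k1 k2 : R) :
  let x := base_point p in
  let a := pd f 0 x in let b := pd f 1 x in
  let A := pd2 f 0 0 x in let B := pd2 f 0 1 x in let C := pd2 f 1 1 x in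
  let D := 1 + a ^+ 2 + b ^+ 2 in
  principal_curvatures f p k1 k2 ->
  D ^+ 3 * (k1 - k2) ^+ 2 =
    ((1 + b ^+ 2) * A - 2 * (a * b) * B + (1 + a ^+ 2) * C) ^+ 2
    - 4 * D * (A * C - B ^+ 2).
Proof.
move=> x a b A B C D; rewrite /principal_curvatures -/x char_poly2.
set S := shape_operator f x => hS.
have [W1 W2] := normal_lengthP a b.
set W := Num.sqrt _ in W1 W2; rewrite -/D in W2.
have W0 : W != 0 by rewrite gt_eqF // (lt_le_trans _ W1).
(* This avoids expanding the inverse: it yields four linear equations in the entries of [S]. *)
have IS : first_form f x *m S = second_form f x.
  by rewrite mulKVmx // first_form_unit.
have I i j : first_form f x i j =
    (i == 0)%:R * (j == 0)%:R + (i == 1)%:R * (j == 1)%:R + pd f i x * pd f j x.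
  by rewrite mxE dotv3 !mxE.
have II i j : second_form f x i j = pd2 f i j x / W.
  rewrite mxE dotv3; have [-> -> ->] := unit_normalE f x.
  by rewrite !mxE /= !mul0r !add0r.
have eqS i j : pd2 f i j x / W =
    first_form f x i 0 * S 0 j + first_form f x i 1 * S 1 j.
  rewrite -II -IS mxE !big_ord_recl big_ord0 addr0.
  by congr (_ + _ * _); congr (fun_of_matrix _ _ _); apply: val_inj.
have e00 := eqS 0 0; have e01 := eqS 0 1.
have e10 := eqS 1 0; have e11 := eqS 1 1.
have B' : pd2 f 1 0 x = B by rewrite /B /pd2 mderiv_comm.
rewrite B' in e10; rewrite -/A in e00; rewrite -/B in e01; rewrite -/C in e11.
rewrite !I /= -/a -/b in e00 e01 e10 e11.
have ht : S 0 0 + S 1 1 = k1 + k2.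
  have := congr1 (fun q : {poly R} => q`_1) hS.
  have -> : ('X - k1%:P) * ('X - k2%:P) =
            'X^2 - (k1 + k2)%:P * 'X + (k1 * k2)%:P :> {poly R}.
    by rewrite polyCD polyCM; ring.
  by rewrite !coefE /= !mulr1 !sub0r !addr0 => /oppr_inj.
have hd : \det S = k1 * k2.
  have := congr1 (horner^~ 0) hS.
  rewrite !hornerE /=; lra.
have -> : (k1 - k2) ^+ 2 = (k1 + k2) ^+ 2 - 4 * (k1 * k2) by ring.
rewrite -ht -hd det2.
move: (S 0 0) (S 0 1) (S 1 0) (S 1 1) e00 e01 e10 e11.
move=> s00 s01 s10 s11 e00 e01 e10 e11.
have tD : D * (s00 + s11) =
    ((1 + b ^+ 2) * A - 2 * (a * b) * B + (1 + a ^+ 2) * C) / W.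
  (* The cross term is split into two copies of [B / W], one replaced through [e10] and the other
     through [e01], since [S] need not be symmetric. *)
  transitivity ((1 + b ^+ 2) * (A / W) - (a * b) * (B / W) - (a * b) * (B / W)
      + (1 + a ^+ 2) * (C / W)); last by ring.
  by rewrite {1}e10 e01 e00 e11 /D; ring.
have dD : D * (s00 * s11 - s01 * s10) = (A * C - B ^+ 2) / D.
  transitivity ((A / W) * (C / W) - (B / W) * (B / W)); last first.
    by rewrite -W2; field.
  by rewrite {1}e10 e01 e00 e11 /D; ring.
transitivity (D * (D * (s00 + s11)) ^+ 2
  - 4 * D ^+ 2 * (D * (s00 * s11 - s01 * s10))); first by ring.
by rewrite tD dD -W2; field.
Qed.

(** With [r] the modulus of the normal coordinate, [1 - r ^+ 2 = 2 / (W + 1)]. As [r < 1] and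
    [W >= 1], this gives [1 - r >= 1 / (W + 1) >= 1 / (2 * W)]; squaring leaves only
    [W ^+ 2 = D]. *)
Lemma d_infty_lower_bound (R : realType) (f : {mpoly R[2]}) (p : 'rV[R]_3) :
  1 <= 4 * (1 + pd f 0 (base_point p) ^+ 2 + pd f 1 (base_point p) ^+ 2)
         * d_infty f p ^+ 2.
Proof.
set x := base_point p.
have := normc_normal_coord f p; have := normc_normal_coord_lt1 f p.
rewrite /d_infty /= -/x.
have : 0 <= normc (normal_coord f p).
  by case: (normal_coord f p) => a b; exact: sqrtr_ge0.
have [] := normal_lengthP (pd f 0 x) (pd f 1 x).
set W := Num.sqrt _; set r := normc _ => W1 <- r0 r1 hr.
have : r ^+ 2 * (W + 1) = W - 1.
  by rewrite hr divfK // gt_eqF //; lra.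
move=> {}hr; have h : 1 <= 2 * W * (1 - r).
  have : (1 - r) * (1 + r) * (W + 1) = 2 by nra.
  have : 0 <= (1 - r) * (1 - r) * (W + 1) by nra.
  have : 0 <= (1 - r) * (W - 1) by nra.
  nra.
have -> : 4 * W ^+ 2 * (1 - r) ^+ 2 = (2 * W * (1 - r)) ^+ 2 by ring.
by rewrite exprn_ege1.
Qed.

(** Dividing by the squared distance costs a factor [4 * D], which lowers [D ^+ 3] to [D ^+ 2]. *)
Lemma curvature_ratio_bound (R : realType) (f : {mpoly R[2]})
    (p : 'rV[R]_3) (k1 k2 : R) :
  let x := base_point p in
  let a := pd f 0 x in let b := pd f 1 x in
  let A := pd2 f 0 0 x in let B := pd2 f 0 1 x in let C := pd2 f 1 1 x in
  let D := 1 + a ^+ 2 + b ^+ 2 in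
  principal_curvatures f p k1 k2 ->
  D ^+ 2 * (`|k1 - k2| / d_infty f p) ^+ 2 <=
    4 * (((1 + b ^+ 2) * A - 2 * (a * b) * B + (1 + a ^+ 2) * C) ^+ 2
    - 4 * D * (A * C - B ^+ 2)).
Proof.
move=> x a b A B C D hk; rewrite -(principal_curvature_gap hk) -/x -/a -/b -/D.
have := d_infty_lower_bound f p; rewrite /= -/x -/a -/b -/D.
have d0 := d_infty_gt0 f p; set d := d_infty f p in d0 * => h.
rewrite exprMn real_normK ?num_real // exprVn [leLHS]mulrA.
rewrite ler_pdivrMr ?exprn_gt0 //.
have -> : 4 * (D ^+ 3 * (k1 - k2) ^+ 2) * d ^+ 2 =
  (D ^+ 2 * (k1 - k2) ^+ 2) * (4 * D * d ^+ 2) by ring.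
by rewrite ler_peMr // mulr_ge0 ?sqr_ge0.
Qed.

Lemma graph_over (R : realType) (f : {mpoly R[2]}) (x : 'rV[R]_2) :
  exists2 p, graph f p & base_point p = x.
Proof.
pose p := vec3 (x 0 0) (x 0 1) f.@[x 0] : 'rV[R]_3.
have hp : base_point p = x.
  apply/rowP => i; rewrite !mxE.
  have : (i == 0) || (i == 1) by case: i => [[|[|]]].
  by case/orP => /eqP ->.
by exists p => //; rewrite /graph /= hp mxE.
Qed.

(** * Algebra of the constant Hessian in degree two *)

(** The equations say that the Hessian minus [l] times the identity is [l] times the rank-one square
    of [(a, b)]. So [l] is an eigenvalue, and the smaller one leaves a positive semidefinite
    remainder. *)
Lemma elliptic_umbilic_pos (R : rcfType) (A B C : R) :
  0 < A -> 0 < A * C - B ^+ 2 ->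
  exists a b l,
    [/\ A = l * (1 + a ^+ 2), B = l * (a * b) & C = l * (1 + b ^+ 2)].
Proof.
move=> A0 d0; pose r := Num.sqrt ((A - C) ^+ 2 + 4 * B ^+ 2).
have r0 : 0 <= r by exact: sqrtr_ge0.
have r2 : r ^+ 2 = (A - C) ^+ 2 + 4 * B ^+ 2.
  by rewrite sqr_sqrtr //; have := sqr_ge0 (A - C); have := sqr_ge0 B; lra.
pose l := (A + C - r) / 2.
have hl : (A - l) * (C - l) = B ^+ 2.
  transitivity ((r ^+ 2 - (A - C) ^+ 2) / 4); first by rewrite /l; field.
  by rewrite r2; field.
have B2 := sqr_ge0 B.
have C0 : 0 < C by nra.
have l0 : 0 < l.
  rewrite /l divr_gt0 // subr_gt0 -(ltr_pXn2r (n:=2)) ?nnegrE //; last by lra.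
  rewrite r2; lra.
have rAC : `|A - C| <= r.
  rewrite -(ler_pXn2r (n:=2)) ?nnegrE // real_normK ?num_real // r2; lra.
have [hA hC] : 0 <= A - l /\ 0 <= C - l.
  move: rAC; rewrite ler_norml /l => /andP[? ?]; split; lra.
(* The diagonal equations fix [a] and [b] only up to sign; [s] gives [a * b] the sign of [B]. *)
pose s := if 0 <= B then 1 else -1 : R.
have s2 : s ^+ 2 = 1 by rewrite /s; case: ifP => _; ring.
have sB : s * `|B| = B.
  rewrite /s; case: ifP => [h|/negbT]; first by rewrite mul1r ger0_norm.
  by rewrite -ltNge => h; rewrite ltr0_norm // mulN1r opprK.
have q0 : 0 <= (A - l) / l by rewrite divr_ge0 // ltW.
have q1 : 0 <= (C - l) / l by rewrite divr_ge0 // ltW.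
have ln0 : l != 0 by rewrite gt_eqF.
exists (Num.sqrt ((A - l) / l)), (s * Num.sqrt ((C - l) / l)), l; split.
- by rewrite sqr_sqrtr //; field.
- rewrite [X in l * X]mulrCA -sqrtrM //.
  have -> : (A - l) / l * ((C - l) / l) = (B / l) ^+ 2.
    by rewrite exprMn -hl; field.
  rewrite sqrtr_sqr normrM (gtr0_norm (x := l^-1)) ?invr_gt0 //.
  by rewrite -[LHS]sB; field.
- by rewrite exprMn s2 mul1r sqr_sqrtr //; field.
Qed.

(** Negating a negative definite Hessian negates [l] and keeps [a] and [b]. *)
Lemma elliptic_umbilic (R : rcfType) (A B C : R) : 0 < A * C - B ^+ 2 ->
  exists a b l,
    [/\ A = l * (1 + a ^+ 2), B = l * (a * b) & C = l * (1 + b ^+ 2)].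
Proof.
move=> d0; have B2 := sqr_ge0 B; have [A0|A0|A0] := ltgtP A 0.
- have [||a [b [l [hA hB hC]]]] := @elliptic_umbilic_pos _ (- A) (- B) (- C).
  + by rewrite oppr_gt0.
  + by rewrite mulrNN sqrrN.
  by exists a, b, (- l); rewrite !mulNr -hA -hB -hC !opprK.
- exact: elliptic_umbilic_pos.
- by exfalso; move: d0; rewrite A0 mul0r; lra.
Qed.

(** The product covers two cases: a zero determinant, where any direction outside the kernel serves,
    and a negative one, where an isotropic direction exists. *)
Lemma isotropic_direction (R : rcfType) (A B C : R) :
  A * C - B ^+ 2 <= 0 -> [|| A != 0, B != 0 | C != 0] ->
  exists x y,
    (A * x ^+ 2 + 2 * B * (x * y) + C * y ^+ 2) * (A * C - B ^+ 2) = 0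
    /\ 0 < (A * x + B * y) ^+ 2 + (B * x + C * y) ^+ 2.
Proof.
move=> dle nz.
have pos (u v : R) : (u != 0) || (v != 0) -> 0 < u ^+ 2 + v ^+ 2.
  case/orP => h.
  - by apply: ltr_wpDr; rewrite ?sqr_ge0 // exprn_even_gt0.
  - by apply: ltr_wpDl; rewrite ?sqr_ge0 // exprn_even_gt0.
have [d0|d0] := eqVneq (A * C - B ^+ 2) 0.
  case/or3P: nz => h.
  - exists 1, 0; rewrite d0 mulr0; split=> //.
    by rewrite !mulr1 !mulr0 !addr0 pos ?h.
  - exists 1, 0; rewrite d0 mulr0; split=> //.
    by rewrite !mulr1 !mulr0 !addr0 pos ?h ?orbT.
  - exists 0, 1; rewrite d0 mulr0; split=> //.
    by rewrite !mulr1 !mulr0 !add0r pos ?h ?orbT.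
have {dle d0} d0 : A * C - B ^+ 2 < 0 by rewrite lt_neqAle d0.
have [A0|A0] := eqVneq A 0.
  exists 1, 0; rewrite A0; split; first by ring.
  rewrite !mulr1 !mulr0 !addr0 pos // orbC.
  by apply/orP; left; apply: contraTneq d0 => ->; rewrite A0 -leNgt; lra.
pose r := Num.sqrt (B ^+ 2 - A * C).
have r2 : r ^+ 2 = B ^+ 2 - A * C by rewrite sqr_sqrtr //; lra.
(* [(r - B) / A] is a root of the form dehomogenized at [y = 1]; the first gradient coordinate is
   then [A * r], which is nonzero. *)
exists (r - B), A; split.
  have -> : A * (r - B) ^+ 2 + 2 * B * ((r - B) * A) + C * A ^+ 2 =
    A * (r ^+ 2 - (B ^+ 2 - A * C)) by ring.
  by rewrite r2 subrr mulr0 mul0r.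
rewrite pos //; have -> : A * (r - B) + B * A = A * r by ring.
by rewrite mulf_neq0 // sqrtr_eq0 -ltNge; lra.
Qed.

(** Here [(a, b)] is the gradient at [(x, y)], and [e] will be the square of the tolerance on the
    ratio. *)
Lemma quadric_small_ratio (R : rcfType) (A B C e : R) : 0 < e ->
  exists x y,
    let a := A * x + B * y in let b := B * x + C * y in
    let D := 1 + a ^+ 2 + b ^+ 2 in
    4 * (((1 + b ^+ 2) * A - 2 * (a * b) * B + (1 + a ^+ 2) * C) ^+ 2
    - 4 * D * (A * C - B ^+ 2)) <= e * D ^+ 2.
Proof.
move=> e0; have [d0|dle] := ltP 0 (A * C - B ^+ 2).
  have [a [b [l [hA hB hC]]]] := elliptic_umbilic d0.
  have n0 : A * C - B ^+ 2 != 0 by rewrite gt_eqF.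
  (* Cramer's rule gives the point where the gradient is [(a, b)]. *)
  pose x := (C * a - B * b) / (A * C - B ^+ 2).
  pose y := (A * b - B * a) / (A * C - B ^+ 2).
  exists x, y.
  have -> : A * x + B * y = a by rewrite /x /y; field.
  have -> : B * x + C * y = b by rewrite /x /y; field.
  move=> /=; set D := 1 + _ + _;
  rewrite [X in X <= _](_ : _ = 0); first by rewrite mulr_ge0 ?sqr_ge0 // ltW.
  by rewrite {}/D hA hB hC; ring.
have [nz|] := boolP [|| A != 0, B != 0 | C != 0]; last first.
  rewrite !negb_or !negbK => /and3P[/eqP-> /eqP-> /eqP->].
  exists 0, 0 => /=; rewrite [X in X <= _](_ : _ = 0); last by ring.
  by rewrite mulr_ge0 ?sqr_ge0 // ltW.
have [x [y [h0 hn]]] := isotropic_direction dle nz.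
set N := _ + _ in hn.
pose M := 4 * ((A + C) ^+ 2 - 4 * (A * C - B ^+ 2)).
have M0 : 0 <= M by rewrite /M; have := sqr_ge0 (A + C); lra.
(* The summand 1 ensures [s ^+ 2 >= s >= M / (e * N)]. *)
pose s := 1 + M / (e * N).
have eN : 0 < e * N by rewrite mulr_gt0.
have q0 : 0 <= M / (e * N) by rewrite divr_ge0 // ltW.
have hs : M <= e * (s ^+ 2 * N).
  have -> : M = e * N * (M / (e * N)) by rewrite mulrC divfK // gt_eqF.
  have -> : e * (s ^+ 2 * N) = e * N * s ^+ 2 by ring.
  by rewrite ler_pM2l // /s; nra.
exists (s * x), (s * y) => /=.
set a := A * _ + _; set b := B * _ + _; set D := 1 + _ + _.
have D1 : 1 <= D by rewrite /D -addrA lerDl addr_ge0 ?sqr_ge0.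
have DN : D = 1 + s ^+ 2 * N by rewrite /D /a /b /N; ring.
(* The terms quadratic in [a] and [b] form the adjugate of the Hessian [H] evaluated at the
   gradient, and [H adj(H) H = det(H) H]. *)
have -> : (1 + b ^+ 2) * A - 2 * (a * b) * B + (1 + a ^+ 2) * C =
    A + C + s ^+ 2 * ((A * x ^+ 2 + 2 * B * (x * y) + C * y ^+ 2)
                      * (A * C - B ^+ 2)).
  by rewrite /a /b; ring.
rewrite h0 mulr0 addr0.
(* Since [D >= 1], the term [(A + C) ^+ 2] is at most [D] times itself. *)
apply: (@le_trans _ _ (M * D)).
  rewrite /M; have := sqr_ge0 (A + C); nra.
rewrite expr2 mulrA ler_pM2r ?(lt_le_trans _ D1) // DN.
by rewrite mulrDr mulr1 ler_wpDl // ltW.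
Qed.

(** * The infimum *)

Theorem theorem2 (R : realType) (d : nat) (f : {mpoly R[2]})
    (hf : f \is d.-homog)
    (kappa1 kappa2 : 'rV[R]_3 -> R)
    (hkappa : forall p, graph f p ->
      principal_curvatures f p (kappa1 p) (kappa2 p)) :
  inf [set `|kappa1 p - kappa2 p| / d_infty f p | p in graph f] = 0.
Proof.
set S := [set _ | p in _].
have [S0 Sb] : has_inf S by exact: curvature_ratio_has_inf.
have S_ge0 : lbound S 0.
  by move=> _ [p _ <-]; rewrite divr_ge0 // ltW // d_infty_gt0.
apply/eqP; rewrite eq_le lb_le_inf // andbT; apply/ler_addgt0Pl => e e0.
rewrite addr0.
pose ratio_num x :=
  4 * (((1 + pd f 1 x ^+ 2) * pd2 f 0 0 x
         - 2 * (pd f 0 x * pd f 1 x) * pd2 f 0 1 x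
         + (1 + pd f 0 x ^+ 2) * pd2 f 1 1 x) ^+ 2
       - 4 * (1 + pd f 0 x ^+ 2 + pd f 1 x ^+ 2)
           * (pd2 f 0 0 x * pd2 f 1 1 x - pd2 f 0 1 x ^+ 2)).
suff [x hx] : exists x, ratio_num x <=
    e ^+ 2 * (1 + pd f 0 x ^+ 2 + pd f 1 x ^+ 2) ^+ 2.
  have [p fp px] := graph_over f x.
  apply: (@le_trans _ _ (`|kappa1 p - kappa2 p| / d_infty f p)).
    by apply: ge_inf => //; exists p.
  have := curvature_ratio_bound (hkappa p fp); rewrite /= px => hr.
  have := le_trans hr hx; rewrite [X in _ <= X]mulrC ler_pM2l.
    rewrite ler_pXn2r ?nnegrE //; last exact: ltW.
    by rewrite divr_ge0 // ltW // d_infty_gt0.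
  rewrite exprn_gt0 //; have := sqr_ge0 (pd f 0 x); have := sqr_ge0 (pd f 1 x).
  lra.
rewrite {}/ratio_num; have [d2|d2] := eqVneq d 2.
  rewrite {}d2 in hf.
  have [x [y hxy]] := quadric_small_ratio (pd2 f 0 0 0) (pd2 f 0 1 0)
    (pd2 f 1 1 0) (exprn_gt0 2 e0).
  exists (\row_(i < 2) [:: x; y]`_i).
  rewrite !homog2_pd2 // !homog2_pd // !mxE /=.
  by have -> : pd2 f 1 0 0 = pd2 f 0 1 0 by rewrite /pd2 mderiv_comm.
(* Every term of the numerator contains a second derivative, so it vanishes at the origin even when
   the gradient does not, as may happen for [d = 1]. *)
have h i j : pd2 f i j 0 = 0.
  by apply: homog_mderiv2_0 hf d2 _ => k; rewrite mxE.
exists 0; rewrite !h [X in X <= _](_ : _ = 0); last by ring.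
by rewrite mulr_ge0 ?sqr_ge0.
Qed.
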